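(* Let $k\geq 1$ and let $\mathcal{H}_k$ be the discrete Heisenberg group of rank $2k$. Then the Nielsen graph $\Gamma_n(\mathcal{H}_k)$ is connected for every $n\geq 2k$.
   Context: The discrete Heisenberg group $\mathcal{H}_k$, $k\ge1$, is the group, under matrix multiplication, of integer $(k+2)\times(k+2)$ matrices of the form $\begin{pmatrix}1&\mathbf{x}&z\\0&I_k&\mathbf{y}\\0&0&1\end{pmatrix}$, where $\mathbf{x}=(x_1,\dots,x_k)$ is an integer row vector, $\mathbf{y}=(y_1,\dots,y_k)^T$ is an integer column vector, $z\in\mathbb{Z}$ and $I_k$ is the $k\times k$ identity matrix. Its rank (minimal number of generators) is $2k$. For a finitely generated group $G$ and $n\ge \operatorname{rank}(G)$, the Nielsen graph $\Gamma_n(G)$ has as vertices the generating $n$-tuples $(g_1,\dots,g_n)\in G^n$, $\langle g_1,\dots,g_n\rangle=G$; two vertices are joined by an edge if one is obtained from the other by an elementary Nielsen move, i.e. by replacing $x_i$ by $x_ix_j^{\pm1}$ or by $x_j^{\pm1}x_i$ for some $j\ne i$, or by replacing $x_j$ by $x_j^{-1}$, the other entries being unchanged. *)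

(* Defs.v *)
From HB Require Import structures.
From Stdlib Require Export Relations.
From mathcomp Require Export all_boot all_order all_algebra.

Set Implicit Arguments.
Unset Strict Implicit.
Unset Printing Implicit Defensive.

Import GRing.Theory.
Local Open Scope ring_scope.

Section Heisenberg.

Variable k : nat.

Definition heis_mx (x : 'rV[int]_k) (y : 'cV[int]_k) (z : int) :
    'M[int]_(1 + (k + 1)) :=
  block_mx 1%:M (row_mx x z%:M)
           0    (block_mx 1%:M y
                          0    1%:M).

(* A decidable form of "M = heis_mx x y z for some x, y, z" (see heisP). *)
Definition is_heis (M : 'M[int]_(1 + (k + 1))) : bool :=
  M == heis_mx (lsubmx (ursubmx M)) (ursubmx (drsubmx M))
               (rsubmx (ursubmx M) 0 0).

Lemma heis_mxP x y z : is_heis (heis_mx x y z).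
Proof.
by rewrite /is_heis /heis_mx !(block_mxKur, block_mxKdr, row_mxKl, row_mxKr) mxE.
Qed.

Lemma heisP M : reflect (exists x y z, M = heis_mx x y z) (is_heis M).
Proof.
apply: (iffP eqP) => [->|[x [y [z ->]]]]; first by do 3!eexists.
exact/eqP/heis_mxP.
Qed.

Lemma heis_mx1 : heis_mx 0 0 0 = 1%:M.
Proof.
by rewrite /heis_mx raddf0 row_mx0 -(scalar_mx_block k 1) -scalar_mx_block.
Qed.

Lemma heis_mxM x y z x' y' z' :
  heis_mx x y z *m heis_mx x' y' z' =
  heis_mx (x + x') (y + y') (z + z' + (x *m y') 0 0).
Proof.
rewrite /heis_mx !mulmx_block !(mul0mx, mulmx0, mul1mx, mulmx1, add0r, addr0).
rewrite mul_row_block !(mulmx0, mulmx1, addr0) add_row_mx.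
rewrite [y' + y]addrC [x' + x]addrC.
congr (block_mx _ (row_mx _ _) _ _).
rewrite [x *m y']mx11_scalar -!raddfD /=; congr _%:M.
by rewrite [_%:M 0 0]mxE eqxx mulr1n [_ + z]addrC addrCA addrA.
Qed.

Record heisenberg := Heisenberg {
  heis_val :> 'M[int]_(1 + (k + 1));
  _ : is_heis heis_val
}.

HB.instance Definition _ := [isSub for heis_val].
HB.instance Definition _ := [Choice of heisenberg by <:].

Definition heis x y z : heisenberg := Heisenberg (heis_mxP x y z).

Lemma heis_valE (A : heisenberg) :
  exists x y z, A = heis_mx x y z :> 'M_(1 + (k + 1)).
Proof. exact/heisP/(valP A). Qed.

Lemma heis_one_subproof : is_heis 1%:M.
Proof. by rewrite -heis_mx1 heis_mxP. Qed.

Lemma heis_mul_subproof (A B : heisenberg) : is_heis (A *m B).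
Proof.
have [[x [y [z ->]]] [x' [y' [z' ->]]]] := (heis_valE A, heis_valE B).
by rewrite heis_mxM heis_mxP.
Qed.

Lemma heis_inv_mx x y z :
  heis_mx (- x) (- y) ((x *m y) 0 0 - z) *m heis_mx x y z = 1%:M.
Proof.
by rewrite heis_mxM !addNr mulNmx [(- _ : matrix _ _ _) 0 0]mxE subrK subrr heis_mx1.
Qed.

Lemma heis_invmxE x y z :
  invmx (heis_mx x y z) = heis_mx (- x) (- y) ((x *m y) 0 0 - z).
Proof.
have MV := heis_inv_mx x y z; have [_ uM] := mulmx1_unit MV.
by rewrite -[LHS]mul1mx -MV mulmxK.
Qed.

Lemma heis_unitmx (A : heisenberg) : (A : 'M_(1 + (k + 1))) \in unitmx.
Proof.
have [x [y [z ->]]] := heis_valE A.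
by have [] := mulmx1_unit (heis_inv_mx x y z).
Qed.

Lemma heis_inv_subproof (A : heisenberg) : is_heis (invmx A).
Proof.
by have [x [y [z ->]]] := heis_valE A; rewrite heis_invmxE heis_mxP.
Qed.

Definition heis_one := Heisenberg heis_one_subproof.
Definition heis_mul A B := Heisenberg (heis_mul_subproof A B).
Definition heis_inv A := Heisenberg (heis_inv_subproof A).

Lemma heis_mulA : associative heis_mul.
Proof. by move=> A B C; apply: val_inj; rewrite /= mulmxA. Qed.

Lemma heis_mul1 : left_id heis_one heis_mul.
Proof. by move=> A; apply: val_inj; rewrite /= mul1mx. Qed.

Lemma heis_mulr1 : right_id heis_one heis_mul.
Proof. by move=> A; apply: val_inj; rewrite /= mulmx1. Qed.

Lemma heis_mulV : left_inverse heis_one heis_inv heis_mul.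
Proof. by move=> A; apply: val_inj; rewrite /= mulVmx ?heis_unitmx. Qed.

Lemma heis_mulrV : right_inverse heis_one heis_inv heis_mul.
Proof. by move=> A; apply: val_inj; rewrite /= mulmxV ?heis_unitmx. Qed.

HB.instance Definition _ :=
  isGroup.Build heisenberg heis_mulA heis_mul1 heis_mulr1 heis_mulV heis_mulrV.

End Heisenberg.

Section NielsenGraph.

Local Open Scope group_scope.

Variables (G : groupType) (n : nat).

Definition is_subgroup (H : G -> Prop) : Prop :=
  [/\ H 1, forall x y, H x -> H y -> H (x * y) & forall x, H x -> H x^-1].

Definition generates (g : {ffun 'I_n -> G}) : Prop :=
  forall H, is_subgroup H -> (forall i, H (g i)) -> forall x, H x.

Definition set_entry (g : {ffun 'I_n -> G}) (i : 'I_n) (a : G) :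
    {ffun 'I_n -> G} :=
  [ffun l => if l == i then a else g l].

Inductive nielsen_move (g : {ffun 'I_n -> G}) : {ffun 'I_n -> G} -> Prop :=
| NielsenMulR i j of j != i : nielsen_move g (set_entry g i (g i * g j))
| NielsenMulVR i j of j != i : nielsen_move g (set_entry g i (g i * (g j)^-1))
| NielsenMulL i j of j != i : nielsen_move g (set_entry g i (g j * g i))
| NielsenMulVL i j of j != i : nielsen_move g (set_entry g i ((g j)^-1 * g i))
| NielsenInv j : nielsen_move g (set_entry g j (g j)^-1).

Definition nielsen_vertex : Type := {g : {ffun 'I_n -> G} | generates g}.

Definition nielsen_edge (u v : nielsen_vertex) : Prop :=
  nielsen_move (sval u) (sval v) \/ nielsen_move (sval v) (sval u).

End NielsenGraph.

(* Connected graphs are nonempty. For an undirected graph, the edge relation E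
   must be symmetric, as nielsen_edge is. *)
Definition connected_graph (V : Type) (E : V -> V -> Prop) : Prop :=
  inhabited V /\ forall u v : V, clos_refl_trans V E u v.

(* Main.v *)
Require Import Defs.
From mathcomp Require Import ring zify.

Set Implicit Arguments.
Unset Strict Implicit.
Unset Printing Implicit Defensive.

Import GRing.Theory.
Local Open Scope ring_scope.

(** The abelianization of the Heisenberg group is Z^(2k), on which Nielsen
    moves act as integral row operations, so Gaussian elimination brings any
    generating tuple to one lifting (e_1, ..., e_2k, 0, ..., 0).  The remaining
    central parts are then removed: X_i and Y_i are multiplied by any central
    element when conjugated by a power of (the lift of) Y_i and X_i, and any
    further entry can be multiplied by the commutator of X_1 with a power
    of Y_1, which is a word in the other entries. *)

(** * Integer powers in a group and morphisms from a group to the integers *)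

Section IntegerPowers.

Variable G : groupType.
Implicit Types (x : G) (m : int).

Definition expgz x m : G :=
  match m with Posz p => (x ^+ p)%g | Negz p => (x ^- p.+1)%g end.

Lemma is_subgroup_expgz (H : G -> Prop) x m :
  is_subgroup H -> H x -> H (expgz x m).
Proof.
move=> [H1 HM HV] Hx.
have HX p : H (x ^+ p)%g.
  by elim: p => [|p IHp]; rewrite ?expg0 // expgS; apply: HM.
by case: m => p; [apply: HX | apply: HV; apply: HX].
Qed.

Lemma is_subgroup_commg (H : G -> Prop) x y :
  is_subgroup H -> H x -> H y -> H [~ x, y]%g.
Proof.
move=> [H1 HM HV] Hx Hy; rewrite commgEl /conjg.
exact: HM (HV _ Hx) (HM _ _ (HV _ Hy) (HM _ _ Hx Hy)).
Qed.

Variables (f : G -> int) (fM : forall x y, f (x * y)%g = f x + f y).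

Lemma int_morph1 : f 1%g = 0.
Proof. by apply: (addrI (f 1%g)); rewrite -fM mulg1 addr0. Qed.

Lemma int_morphV x : f x^-1%g = - f x.
Proof. by apply: (addrI (f x)); rewrite -fM mulgV subrr int_morph1. Qed.

Lemma int_morph_expgz x m : f (expgz x m) = m * f x.
Proof.
have fX p : f (x ^+ p)%g = p%:Z * f x.
  elim: p => [|p IHp]; first by rewrite expg0 int_morph1 mul0r.
  by rewrite expgS fM IHp intS mulrDl mul1r.
by case: m => p; rewrite /= ?int_morphV fX // NegzE mulNr.
Qed.

End IntegerPowers.

(** * Nielsen equivalence of tuples and paths in the Nielsen graph *)

Section NielsenEquivalence.

Variables (G : groupType) (n : nat).
Implicit Types (g h : {ffun 'I_n -> G}) (i j : 'I_n).

Definition nielsen_equiv := clos_refl_sym_trans _ (@nielsen_move G n).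

Lemma set_entry_same g i (a : G) : set_entry g i a i = a.
Proof. by rewrite ffunE eqxx. Qed.

Lemma set_entry_other g i (a : G) l : l != i -> set_entry g i a l = g l.
Proof. by rewrite ffunE => /negPf ->. Qed.

Lemma set_entry_id g i : set_entry g i (g i) = g.
Proof. by apply/ffunP => l; rewrite ffunE; case: eqP => [->|]. Qed.

Lemma set_entry_set g i (a b : G) :
  set_entry (set_entry g i a) i b = set_entry g i b.
Proof. by apply/ffunP => l; rewrite !ffunE; case: eqP. Qed.

Lemma nielsen_equiv_trans g h k :
  nielsen_equiv g h -> nielsen_equiv h k -> nielsen_equiv g k.
Proof. exact: rst_trans. Qed.

(** Reduces multiplication by a word in the other entries to multiplication by a single entry.
    Quantifying over every [x] is what gives inverses: the equivalence for [w], started at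
    [x * w^-1], is read backwards. *)
Lemma nielsen_mulr_subgroup g i :
  is_subgroup (fun w => forall x,
    nielsen_equiv (set_entry g i x) (set_entry g i (x * w)%g)).
Proof.
split=> [x|v w Wv Ww x|w Ww x]; first by rewrite mulg1; apply: rst_refl.
- by rewrite mulgA; apply: nielsen_equiv_trans (Wv x) (Ww _).
- by apply: rst_sym; rewrite -{2}[x](mulgVK w); apply: Ww.
Qed.

Lemma nielsen_mull_subgroup g i :
  is_subgroup (fun w => forall x,
    nielsen_equiv (set_entry g i x) (set_entry g i (w * x)%g)).
Proof.
split=> [x|v w Wv Ww x|w Ww x]; first by rewrite mul1g; apply: rst_refl.
- by rewrite -mulgA; apply: nielsen_equiv_trans (Ww x) (Wv _).
- by apply: rst_sym; rewrite -{2}[x](mulVKg w); apply: Ww.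
Qed.

Lemma nielsen_mulr_entry g i j x : j != i ->
  nielsen_equiv (set_entry g i x) (set_entry g i (x * g j)%g).
Proof.
move=> ji; apply: rst_step.
have := NielsenMulR (set_entry g i x) ji.
by rewrite set_entry_set set_entry_same set_entry_other.
Qed.

Lemma nielsen_mull_entry g i j x : j != i ->
  nielsen_equiv (set_entry g i x) (set_entry g i (g j * x)%g).
Proof.
move=> ji; apply: rst_step.
have := NielsenMulL (set_entry g i x) ji.
by rewrite set_entry_set set_entry_same set_entry_other.
Qed.

Lemma nielsen_mulr_expgz g i j m : j != i ->
  nielsen_equiv g (set_entry g i (g i * expgz (g j) m)%g).
Proof.
move=> ji; rewrite -{1}(set_entry_id g i).
have Wj := fun x => nielsen_mulr_entry g x ji.
exact: (is_subgroup_expgz m (nielsen_mulr_subgroup g i) Wj (g i)).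
Qed.

(** Conjugation is a right multiplication by the power followed by a left multiplication by its
    inverse. *)
Lemma nielsen_conj_expgz g i j m : j != i ->
  nielsen_equiv g (set_entry g i (g i ^ expgz (g j) m)%g).
Proof.
move=> ji; apply: nielsen_equiv_trans (nielsen_mulr_expgz g m ji) _.
have sL := nielsen_mull_subgroup g i; have [_ _ LV] := sL.
have Lj := fun x => nielsen_mull_entry g x ji.
exact: (LV _ (is_subgroup_expgz m sL Lj) _).
Qed.

Lemma nielsen_mulr_commg g i p q m : p != i -> q != i ->
  nielsen_equiv g (set_entry g i (g i * [~ g p, expgz (g q) m])%g).
Proof.
move=> pi qi; rewrite -{1}(set_entry_id g i).
have sR := nielsen_mulr_subgroup g i.
have Wp := fun x => nielsen_mulr_entry g x pi.
have Wq := is_subgroup_expgz m sR (fun x => nielsen_mulr_entry g x qi).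
exact: (is_subgroup_commg sR Wp Wq (g i)).
Qed.

(** A move changes one entry only, and the old entry is recovered from the new tuple by products and
    inverses. *)
Lemma nielsen_move_subgroup g h (H : G -> Prop) : is_subgroup H ->
  nielsen_move g h -> (forall l, H (g l)) <-> (forall l, H (h l)).
Proof.
move=> [H1 HM HV] [i j ji|i j ji|i j ji|i j ji|j];
  split=> Hg l; do ?[by rewrite ffunE; case: eqP => // _; auto].
1-4: have Hl l' : l' != i -> H (g l') by
       move=> l'i; have:= Hg l'; rewrite set_entry_other.
1-4: have [->|/Hl//] := eqVneq l i; have := Hg i;
     rewrite set_entry_same => Hi.
- by rewrite -[g i](mulgK (g j)); auto.
- by rewrite -[g i](mulgVK (g j)); auto.
- by rewrite -[g i](mulKg (g j)); auto.
- by rewrite -[g i](mulVKg (g j)); auto.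
have := Hg l; rewrite ffunE; case: eqP => // -> /HV.
by rewrite invgK.
Qed.

Lemma nielsen_move_generates g h :
  nielsen_move g h -> generates g <-> generates h.
Proof.
move=> gh; split=> gen H sH Hl; apply: gen => //;
  exact/(nielsen_move_subgroup sH gh).
Qed.

Lemma nielsen_equiv_generates g h :
  nielsen_equiv g h -> generates g <-> generates h.
Proof.
elim=> {g h} [g h /nielsen_move_generates //|g //|g h _ IH|g h k _ IH1 _ IH2].
- exact: iff_sym.
- exact: iff_trans IH1 IH2.
Qed.

Lemma nielsen_edge_sym (u v : nielsen_vertex G n) :
  nielsen_edge u v -> nielsen_edge v u.
Proof. by case; [right | left]. Qed.

Lemma nielsen_path_sym (u v : nielsen_vertex G n) :
  clos_refl_trans _ (@nielsen_edge G n) u v ->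
  clos_refl_trans _ (@nielsen_edge G n) v u.
Proof.
elim=> {u v} [u v /nielsen_edge_sym|u|u v w _ uv _ vw].
- exact: rt_step.
- exact: rt_refl.
- exact: rt_trans vw uv.
Qed.

(* Vertices carry generation proofs, so two of them with the same entries need
   not be equal; but they have a common neighbour as soon as n > 0. *)
Lemma nielsen_path_same (u v : nielsen_vertex G n) : (0 < n)%N ->
  sval u = sval v -> clos_refl_trans _ (@nielsen_edge G n) u v.
Proof.
case: u v => [g gen_g] [h gen_h] n_gt0 /= gh; subst h.
have gw := NielsenInv g (Ordinal n_gt0).
have [gen_w _] := nielsen_move_generates gw.
by apply: (@rt_trans _ _ _ (exist _ _ (gen_w gen_g)));
  apply: rt_step; [left | right].
Qed.

(** Every tuple met along an equivalence generates too, so it is a vertex of the graph. *)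
Lemma nielsen_equiv_path (u v : nielsen_vertex G n) : (0 < n)%N ->
  nielsen_equiv (sval u) (sval v) -> clos_refl_trans _ (@nielsen_edge G n) u v.
Proof.
case: u v => [g gen_g] [h gen_h] n_gt0 /= gh.
elim: gh gen_g gen_h => {g h}
  [g h gh|g|g h _ IH|g h k gh IH1 _ IH2] gen_g gen_h.
- by apply: rt_step; left.
- exact: nielsen_path_same.
- exact/nielsen_path_sym/IH.
- have gen_m := (nielsen_equiv_generates gh).1 gen_g.
  exact: rt_trans (IH1 gen_g gen_m) (IH2 gen_m gen_h).
Qed.

(** * Euclidean algorithm and elimination for one integer-valued morphism *)

Section Euclid.

Variables (f : G -> int) (fM : forall x y, f (x * y)%g = f x + f y).
Variables (K : G -> Prop) (sK : is_subgroup K).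

(** Euclid's algorithm on the values of [f] at [i] and [j], by induction on a bound for the value at
    [i]. The subgroup [K] serves to keep coordinates that vanish already equal to zero. *)
Lemma nielsen_euclid_pair g i j : i != j -> K (g i) -> K (g j) ->
  exists g', [/\ nielsen_equiv g g', K (g' i), K (g' j), f (g' i) = 0
    & forall l, l != i -> l != j -> g' l = g l].
Proof.
move=> ij; have ji : j != i by rewrite eq_sym.
have [N] := ubnP `|f (g i)|%N; elim: N g => // N IH g ltN Ki Kj.
have [fi0|fi_neq0] := eqVneq (f (g i)) 0.
  by exists g; split=> //; apply: rst_refl.
have [_ KM KV] := sK.
(* g1 reduces f (g j) to r, its remainder modulo f (g i); the next three moves
   turn the values (f (g i), r) into (r, - f (g i)). *)
pose q := (f (g j) %/ f (g i))%Z.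
pose g1 := set_entry g j (g j * expgz (g i) (- q))%g.
pose g2 := set_entry g1 i (g1 i * expgz (g1 j) 1)%g.
pose g3 := set_entry g2 j (g2 j * expgz (g2 i) (-1))%g.
pose g4 := set_entry g3 i (g3 i * expgz (g3 j) 1)%g.
have g14 : nielsen_equiv g g4.
  apply: nielsen_equiv_trans (nielsen_mulr_expgz _ _ ij) _.
  apply: nielsen_equiv_trans (nielsen_mulr_expgz _ _ ji) _.
  apply: nielsen_equiv_trans (nielsen_mulr_expgz _ _ ij) _.
  exact: nielsen_mulr_expgz.
have g1i : g1 i = g i by rewrite set_entry_other.
have K1j : K (g1 j).
  by rewrite set_entry_same; apply: KM => //; apply: is_subgroup_expgz.
have g2j : g2 j = g1 j by rewrite set_entry_other.
have K2i : K (g2 i).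
  rewrite set_entry_same g1i; apply: KM => //; exact: is_subgroup_expgz.
have g3i : g3 i = g2 i by rewrite set_entry_other.
have K3j : K (g3 j).
  rewrite set_entry_same g2j; apply: KM => //; exact: is_subgroup_expgz.
have g4j : g4 j = g3 j by rewrite set_entry_other.
have K4i : K (g4 i).
  rewrite set_entry_same g3i; apply: KM => //; exact: is_subgroup_expgz.
have f1j : f (g1 j) = (f (g j) %% f (g i))%Z.
  by rewrite set_entry_same fM (int_morph_expgz fM) /modz mulNr.
have f4i : f (g4 i) = f (g1 j).
  rewrite set_entry_same fM (int_morph_expgz fM) g3i.
  rewrite [g3 j]set_entry_same fM (int_morph_expgz fM) g2j; ring.
have lt4 : (`|f (g4 i)| < N)%N.
  by rewrite f4i f1j; have := ltz_mod (f (g j)) fi_neq0;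
     have := modz_ge0 (f (g j)) fi_neq0; lia.
have K4j : K (g4 j) by rewrite g4j.
have [g' [g4g' K'i K'j f'i g'E]] := IH g4 lt4 K4i K4j.
exists g'; split=> // [|l li lj]; first exact: nielsen_equiv_trans g14 g4g'.
by rewrite g'E // !set_entry_other.
Qed.

(** The entries of [s] are cleared in turn against the pivot [j]; each round touches only two
    entries, so earlier zeros survive. *)
Lemma nielsen_euclid g j (s : seq 'I_n) : j \notin s ->
  (forall l, l \in j :: s -> K (g l)) ->
  exists g', [/\ nielsen_equiv g g', forall l, l \in j :: s -> K (g' l),
    forall l, l \in s -> f (g' l) = 0
    & forall l, l \notin j :: s -> g' l = g l].
Proof.
elim: s => [|i s IH].
  by move=> _ Kg; exists g; split=> //; apply: rst_refl.
rewrite inE negb_or => /andP[ji js] Kg.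
have [|g1 [gg1 K1 f1 g1E]] := IH js.
  by move=> l; rewrite inE => /orP[] ls; apply: Kg; rewrite !inE ls ?orbT.
have Kg1 l : l \in [:: j, i & s] -> K (g1 l).
  move=> ls; have [/K1//|ls'] := boolP (l \in j :: s).
  by rewrite g1E //; apply: Kg.
have ij : i != j by rewrite eq_sym.
have [| |g2 [g12 K2i K2j f2i g2E]] := @nielsen_euclid_pair g1 i j ij.
- by apply: Kg1; rewrite !inE eqxx orbT.
- by apply: Kg1; rewrite !inE eqxx.
exists g2; split=> [|l ls|l|l].
- exact: nielsen_equiv_trans gg1 g12.
- have [->//|li] := eqVneq l i; have [->//|lj] := eqVneq l j.
  by rewrite g2E //; apply: Kg1.
- rewrite inE; have [->//|li /= ls] := eqVneq l i.
  by rewrite g2E ?f1 //; apply: contraNneq js => <-.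
- rewrite !inE !negb_or => /and3P[lj li ls].
  by rewrite g2E // g1E // inE negb_or lj.
Qed.

(** Subtracting multiples of a pivot of value 1. The last conclusion lets other coordinates be
    followed through the change. *)
Lemma nielsen_clear g j (s : seq 'I_n) : j \notin s -> f (g j) = 1 ->
  exists g', [/\ nielsen_equiv g g', forall l, l \notin s -> g' l = g l,
    forall l, l \in s -> f (g' l) = 0
    & forall l, exists m, g' l = (g l * expgz (g j) m)%g].
Proof.
move=> js fj; elim: s js => [|i s IH].
  move=> _; exists g; split=> //; first exact: rst_refl.
  by move=> l; exists 0; rewrite mulg1.
rewrite inE negb_or => /andP[ji js].
have [g1 [gg1 g1E f1 g1m]] := IH js.
(* The list may repeat an index; one that is cleared already is left alone. *)
have [is_|is_] := boolP (i \in s).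
  exists g1; split=> // l; first by rewrite inE negb_or => /andP[_ /g1E].
  by rewrite inE => /orP[/eqP->|]; apply: f1.
have g1j := g1E _ js.
exists (set_entry g1 i (g1 i * expgz (g1 j) (- f (g1 i)))%g); split=> [|l|l|l].
- exact: nielsen_equiv_trans gg1 (nielsen_mulr_expgz _ _ ji).
- by rewrite inE negb_or => /andP[li ls]; rewrite set_entry_other ?g1E.
- rewrite inE; have [-> _|li /= ls] := eqVneq l i.
    by rewrite set_entry_same fM (int_morph_expgz fM) g1j fj mulr1 subrr.
  by rewrite set_entry_other ?f1.
- have [->|li] := eqVneq l i; last by rewrite set_entry_other.
  by exists (- f (g1 i)); rewrite set_entry_same g1j (g1E i).
Qed.

End Euclid.

End NielsenEquivalence.

(** * Gaussian elimination on the coordinates of a generating tuple *)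

Section Abelianization.

Variables (G : groupType) (m n : nat) (c : 'I_m -> G -> int).
Hypothesis cM : forall l x y, c l (x * y)%g = c l x + c l y.
Variables (E : 'I_m -> G) (cE : forall l l', c l (E l') = (l == l')%:R).
Variables (e : 'I_m -> 'I_n) (e_inj : injective e).
Implicit Types (g : {ffun 'I_n -> G}) (s : seq 'I_m).

(* When d divides the entries of column l0 outside the rows already reduced,
   a combination of the columns gives a morphism to Z/d killing the
   tuple, but sending E l0 to 1. *)
Lemma generates_coord_unit g s l0 (d : int) : generates g -> l0 \notin s ->
  (forall l i, l \in s -> c l (g i) = (i == e l)%:R) ->
  (forall i, i \notin map e s -> (d %| c l0 (g i))%Z) -> `|d|%N = 1%N.
Proof.
move=> gen_g l0s gs gd.
pose F x := c l0 x - \sum_(l | l \in s) c l x * c l0 (g (e l)).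
have FM x y : F (x * y)%g = F x + F y.
  rewrite /F cM (eq_bigr (fun l => c l x * c l0 (g (e l)) +
    c l y * c l0 (g (e l)))); last by move=> l _; rewrite cM mulrDl.
  rewrite big_split /=; ring.
have : (d %| F (E l0))%Z.
  apply: (gen_g (fun x => d %| F x)%Z) => [|i].
    split=> [|x y dx dy|x dx]; first by rewrite (int_morph1 FM) dvdz0.
    - by rewrite FM rpredD.
    - by rewrite (int_morphV FM) rpredN.
  have [/mapP[l ls ->]|ins] := boolP (i \in map e s).
    rewrite /F (bigD1 l) //= (gs l) // eqxx mul1r big1 ?addr0 ?subrr ?dvdz0 //.
    move=> l' /andP[l's l'l]; rewrite (gs l') // (inj_eq e_inj) eq_sym.
    by rewrite (negPf l'l) mul0r.
  rewrite /F big1 ?subr0 ?gd // => l ls.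
  rewrite (gs l) //; case: eqP => [ile|]; last by rewrite mul0r.
  by rewrite ile map_f in ins.
rewrite /F cE eqxx big1 ?subr0; last first.
  move=> l ls; rewrite cE; case: eqP => [ll|]; last by rewrite mul0r.
  by rewrite ll (negPf l0s) in ls.
by rewrite dvdzE dvdn1 => /eqP.
Qed.

(** Elimination column by column. Rows outside [map e s] vanish in the earlier columns, so running
    Euclid among them for column [l0] does not disturb those; generation forces the resulting pivot
    at [e l0] to be a unit, which then clears the column. *)
Lemma nielsen_reduce_coords g s : uniq s -> generates g ->
  exists2 g', nielsen_equiv g g'
    & forall l i, l \in s -> c l (g' i) = (i == e l)%:R.
Proof.
elim: s => [|l0 s IH] /=; first by move=> _ _; exists g => //; apply: rst_refl.
move=> /andP[l0s us] gen_g; have [g1 gg1 g1s] := IH us gen_g.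
have gen1 := (nielsen_equiv_generates gg1).1 gen_g.
pose K x := forall l, l \in s -> c l x = 0.
have sK : is_subgroup K.
  split=> [l _|x y Kx Ky l ls|x Kx l ls]; first exact: (int_morph1 (cM l)).
  - by rewrite cM Kx ?Ky.
  - by rewrite (int_morphV (cM l)) Kx ?oppr0.
have K1 i : i \notin map e s -> K (g1 i).
  move=> is_ l ls; rewrite g1s //; case: eqP => // ile.
  by rewrite ile map_f in is_.
set j := e l0; have js : j \notin map e s by rewrite mem_map.
(* With the pivot [j], these are exactly the rows not yet assigned to a column. *)
pose r := [seq i <- enum 'I_n | (i \notin map e s) && (i != j)].
have mem_r i : (i \in r) = (i \notin map e s) && (i != j).
  by rewrite mem_filter mem_enum andbT.
have mem_jr i : (i \in j :: r) = (i \notin map e s).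
  by rewrite inE mem_r; case: (eqVneq i j) => [->|]; rewrite ?js ?andbT.
have jr : j \notin r by rewrite mem_r eqxx andbF.
have [|g2 [g12 K2 f2 g2E]] := nielsen_euclid (cM l0) sK jr (g := g1).
  by move=> l; rewrite mem_jr; apply: K1.
have g2s l i : l \in s -> c l (g2 i) = (i == e l)%:R.
  move=> ls; have [ijr|ijr] := boolP (i \in j :: r); last by rewrite g2E ?g1s.
  rewrite K2 //; case: eqP => // ile.
  by rewrite mem_jr ile map_f in ijr.
have gen2 := (nielsen_equiv_generates g12).1 gen1.
have unit_d : `|c l0 (g2 j)|%N = 1%N.
  apply: (generates_coord_unit gen2 l0s g2s) => i.
  rewrite -mem_jr inE => /orP[/eqP->|ir]; first exact: dvdzz.
  by rewrite f2 ?dvdz0.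
(* The pivot is 1 or -1; an inversion move corrects the sign. *)
have [g3 [g23 g3E K3 f3]] : exists g3, [/\ nielsen_equiv g2 g3,
    forall i, i != j -> g3 i = g2 i, K (g3 j) & c l0 (g3 j) = 1].
  have K2j : K (g2 j) by apply: K2; rewrite inE eqxx.
  have [c1|cN1] : c l0 (g2 j) = 1 \/ c l0 (g2 j) = -1 by lia.
    by exists g2; split=> //; apply: rst_refl.
  exists (set_entry g2 j (g2 j)^-1%g); split=> [|i|l|].
  - by apply: rst_step; apply: NielsenInv.
  - exact: set_entry_other.
  - by rewrite set_entry_same => ls; rewrite (int_morphV (cM l)) K2j ?oppr0.
  - by rewrite set_entry_same (int_morphV (cM l0)) cN1 opprK.
(* Only the rows of [map e s] remain to be cleared in column [l0]. The pivot row lies in [K], so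
   their earlier coordinates do not change. *)
have [g4 [g34 g4E f4 g4m]] := nielsen_clear (cM l0) js f3.
exists g4 => [|l i].
  apply: nielsen_equiv_trans gg1 _; apply: nielsen_equiv_trans g12 _.
  exact: nielsen_equiv_trans g23 g34.
rewrite inE; have [-> _|ll0 /= ls] := eqVneq l l0.
  have [ies|ies] := boolP (i \in map e s).
    by rewrite f4 //; case: eqP => // ij; rewrite ij (negPf js) in ies.
  rewrite g4E //; have [->|ij] := eqVneq i j; first by rewrite f3.
  by rewrite g3E // f2 ?(negPf ij) // mem_r ies.
have [w ->] := g4m i; rewrite cM (int_morph_expgz (cM l)) K3 // mulr0 addr0.
have [->|ij] := eqVneq i j; last by rewrite g3E ?g2s.
by rewrite K3 // (inj_eq e_inj) eq_sym (negPf ll0).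
Qed.

End Abelianization.

(** * Abelian coordinates, commutators and generators of the Heisenberg group *)

Section HeisenbergCoordinates.

Variable k : nat.
Implicit Types (A B : heisenberg k) (l : 'I_(k + k)) (a : 'I_k).

(** The coordinates of the image in the abelianization: indices [lshift k a] read the row part,
    indices [rshift k a] the column part. *)
Definition heis_coord l A : int :=
  row_mx (lsubmx (ursubmx A)) (ursubmx (drsubmx A))^T 0 l.

Lemma heis_coord_heis l x y z : heis_coord l (heis x y z) = row_mx x y^T 0 l.
Proof.
by rewrite /heis_coord /= /heis_mx !(block_mxKur, block_mxKdr, row_mxKl).
Qed.

Lemma heis_eta A : exists x y z, A = heis x y z.
Proof.
by have [x [y [z Ae]]] := heis_valE A; exists x, y, z; apply: val_inj.
Qed.

Lemma heis_mulE x y z x' y' z' : (@heis k x y z * heis x' y' z')%g =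
  heis (x + x') (y + y') (z + z' + (x *m y') 0 0).
Proof. by apply: val_inj; apply: heis_mxM. Qed.

Lemma heis_coordM l A B :
  heis_coord l (A * B)%g = heis_coord l A + heis_coord l B.
Proof.
have [[x [y [z ->]]] [x' [y' [z' ->]]]] := (heis_eta A, heis_eta B).
by rewrite heis_mulE !heis_coord_heis linearD -add_row_mx mxE.
Qed.

Lemma eq_heis_coord A B : (forall l, heis_coord l A = heis_coord l B) ->
  exists m, A = (B * heis 0 0 m)%g.
Proof.
have [[x [y [z ->]]] [x' [y' [z' ->]]]] := (heis_eta A, heis_eta B).
move=> cAB; exists (z - z').
have /eq_row_mx[xE /trmx_inj yE] : row_mx x y^T = row_mx x' y'^T.
  by apply/rowP => l; have := cAB l; rewrite !heis_coord_heis.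
by rewrite heis_mulE xE yE !addr0 mulmx0 mxE addr0 addrC subrK.
Qed.

(** The sum is the standard symplectic form of the two coordinate vectors. *)
Lemma heis_commgE A B : [~ A, B]%g = heis 0 0 (\sum_a
  (heis_coord (lshift k a) A * heis_coord (rshift k a) B -
   heis_coord (lshift k a) B * heis_coord (rshift k a) A)).
Proof.
(* Comparing [A * B] with [B * A * [~ A, B]] avoids computing inverses. *)
apply: (mulgI (B * A)%g); rewrite -commgC.
have [[x [y [z ->]]] [x' [y' [z' ->]]]] := (heis_eta A, heis_eta B).
rewrite !heis_mulE mulmx0 !addr0 [(0 : 'M[int]_1) 0 0]mxE addr0
  [x' + x]addrC [y' + y]addrC.
congr heis; rewrite !mxE sumrB.
under [X in _ + (X - _)]eq_bigr do
  rewrite !heis_coord_heis row_mxEl row_mxEr [y'^T _ _]mxE.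
under [X in _ + (_ - X)]eq_bigr do
  rewrite !heis_coord_heis row_mxEl row_mxEr [y^T _ _]mxE.
ring.
Qed.

(** The commutator sees only coordinates, so any lifts of a symplectic pair of basis vectors reach
    every central element. *)
Lemma heis_commg_dual a A B m :
  (forall l, heis_coord l A = (l == lshift k a)%:R) ->
  (forall l, heis_coord l B = (l == rshift k a)%:R) ->
  [~ A, expgz B m]%g = heis 0 0 m /\ [~ B, expgz A m]%g = heis 0 0 (- m).
Proof.
move=> cA cB; have coordX l := int_morph_expgz (heis_coordM l).
have idE := (eqxx, eq_lrshift, eq_rlshift, eq_lshift, eq_rshift).
split; rewrite heis_commgE (bigD1 a) //= big1 => [|b /negPf ba].
- by congr heis; rewrite !coordX !cA !cB !idE /=; ring.
- by rewrite !coordX !cA !cB !idE ba /=; ring.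
- by congr heis; rewrite !coordX !cA !cB !idE /=; ring.
- by rewrite !coordX !cA !cB !idE ba /=; ring.
Qed.

Definition heis_gen l : heisenberg k :=
  heis (lsubmx (delta_mx 0 l)) (rsubmx (delta_mx 0 l))^T 0.

Lemma heis_coord_gen l l' : heis_coord l (heis_gen l') = (l == l')%:R.
Proof. by rewrite heis_coord_heis trmxK hsubmxK mxE. Qed.

(** Commutators of one dual pair of generators give the centre. Any element becomes central once
    powers of the generators have stripped off its coordinates one by one. *)
Lemma heis_gen_generates (H : heisenberg k -> Prop) : (0 < k)%N ->
  is_subgroup H -> (forall l, H (heis_gen l)) -> forall A, H A.
Proof.
move=> k_gt0 sH Hgen; have [H1 HM HV] := sH.
have Hcentre m : H (heis 0 0 m).
  pose a := Ordinal k_gt0.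
  have [<- _] := heis_commg_dual m (heis_coord_gen^~ (lshift k a))
    (heis_coord_gen^~ (rshift k a)).
  by apply: is_subgroup_commg => //; apply: is_subgroup_expgz.
have Hs (s : seq 'I_(k + k)) A :
    (forall l, l \notin s -> heis_coord l A = 0) -> H A.
  elim: s A => [|l0 s IH] A cA.
    have [l|m ->] := @eq_heis_coord A 1%g.
      by rewrite cA // (int_morph1 (heis_coordM l)).
    exact: HM.
  pose w := expgz (heis_gen l0) (heis_coord l0 A).
  have Hw : H w by apply: is_subgroup_expgz.
  rewrite -[A](mulgVK w); apply: HM => //; apply: IH => l ls.
  rewrite heis_coordM (int_morphV (heis_coordM l)).
  rewrite (int_morph_expgz (heis_coordM l)) heis_coord_gen.
  have [->|ll0] := eqVneq l l0; first by rewrite mulr1 subrr.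
  by rewrite mulr0 subr0 cA // inE negb_or ll0.
by move=> A; apply: (Hs (enum 'I_(k + k))) => l; rewrite mem_enum.
Qed.

(** * Normal form of generating tuples and removal of central factors *)

Section Tuples.

Variables (n : nat) (e : 'I_(k + k) -> 'I_n) (e_inj : injective e).
Hypothesis k_gt0 : (0 < k)%N.
Implicit Types g h : {ffun 'I_n -> heisenberg k}.

(** Central parts are left free: entries outside the image of [e] are central but may be
    nontrivial. *)
Definition lifts_basis g :=
  forall l i, heis_coord l (g i) = (i == e l)%:R.

Lemma nielsen_mulr_centre g i m : lifts_basis g ->
  nielsen_equiv g (set_entry g i (g i * heis 0 0 m)%g).
Proof.
move=> cg.
have ge l l' : heis_coord l (g (e l')) = (l == l')%:R.
  by rewrite cg (inj_eq e_inj) eq_sym.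
have dual a m' := heis_commg_dual m' (ge^~ (lshift k a)) (ge^~ (rshift k a)).
have [/codomP[l ->]|ie] := boolP (i \in codom e).
  (* Since [x * [~ x, w]] is the conjugate [x ^ w], it suffices to conjugate by a power of the dual
     entry; the form is alternating, hence the exponent [- m] in the second case. *)
  rewrite -(splitK l); case: (split l) => a /=.
    have [<- _] := dual a m; rewrite commgEl mulVKg.
    by apply: nielsen_conj_expgz; rewrite (inj_eq e_inj) eq_rlshift.
  have [_] := dual a (- m); rewrite opprK => <-; rewrite commgEl mulVKg.
  by apply: nielsen_conj_expgz; rewrite (inj_eq e_inj) eq_lrshift.
have [<- _] := dual (Ordinal k_gt0) m.
by apply: nielsen_mulr_commg; apply: contraNneq ie => <-; apply: codom_f.
Qed.

(** Corresponding entries differ by a central factor. These are corrected one index at a time, which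
    leaves all coordinates unchanged. *)
Lemma nielsen_equiv_lifts_basis g h :
  lifts_basis g -> lifts_basis h -> nielsen_equiv g h.
Proof.
move=> cg ch.
have [g' gg' g'E] : exists2 g', nielsen_equiv g g' &
    lifts_basis g' /\ forall i, i \in enum 'I_n -> g' i = h i.
  elim: (enum 'I_n) => [|i s [g1 gg1 [cg1 g1h]]].
    by exists g; [apply: rst_refl | split].
  have [l|m hi] := @eq_heis_coord (h i) (g1 i); first by rewrite ch cg1.
  exists (set_entry g1 i (h i)); last split=> [l j|j].
  - apply: nielsen_equiv_trans gg1 _; rewrite hi.
    exact: nielsen_mulr_centre.
  - by rewrite ffunE; case: eqP => [->|_]; rewrite ?ch ?cg1.
  - by rewrite inE ffunE; have [->|_ /g1h] := eqVneq j i.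
suff <- : g' = h by [].
by apply/ffunP => i; apply: g'E.2; rewrite mem_enum.
Qed.

Lemma generates_lifts_basis g : generates g ->
  exists2 g', nielsen_equiv g g' & lifts_basis g'.
Proof.
move=> gen_g.
have [g' gg' cg'] := nielsen_reduce_coords heis_coordM heis_coord_gen
  e_inj (enum_uniq 'I_(k + k)) gen_g.
by exists g' => // l i; apply: cg'; rewrite mem_enum.
Qed.

Lemma heis_generating_tuple : exists g, generates g.
Proof.
exists [ffun i => if [pick l | e l == i] is Some l then heis_gen l else 1%g].
move=> H sH Hg; apply: (heis_gen_generates k_gt0 sH) => l.
have := Hg (e l); rewrite ffunE; case: pickP => [l' /eqP/e_inj -> //|/(_ l)].
by rewrite eqxx.
Qed.

End Tuples.

End HeisenbergCoordinates.

Theorem theorem1p5 (k n : nat) (k_ge1 : (1 <= k)%N) (n_ge2k : (2 * k <= n)%N) :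
  connected_graph (@nielsen_edge (heisenberg k) n).
Proof.
have le_kkn : (k + k <= n)%N by rewrite addnn -mul2n.
(* The first [k + k] positions of the tuple receive the basis vectors. *)
have e_inj : injective (widen_ord le_kkn)
  by move=> l l' ll'; apply: val_inj; apply: (congr1 val ll').
have n_gt0 : (0 < n)%N by lia.
split.
  have [g gen_g] := heis_generating_tuple e_inj k_ge1.
  exact: (inhabits (exist _ g gen_g)).
move=> [g gen_g] [h gen_h]; apply: nielsen_equiv_path => //=.
have [g' gg' cg'] := generates_lifts_basis e_inj gen_g.
have [h' hh' ch'] := generates_lifts_basis e_inj gen_h.
apply: nielsen_equiv_trans gg' _.
apply: nielsen_equiv_trans (rst_sym _ _ _ _ hh').
exact: nielsen_equiv_lifts_basis e_inj k_ge1 _ _ cg' ch'.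
Qed.
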